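(* Let $t\ge 1$ be an integer. Then $\chi_p(P_{2t}\Diamond_2 C_3)\le 3$ if $t=1$, $\chi_p(P_{2t}\Diamond_2 C_3)\le 4$ if $2\le t\le 3$, and $\chi_p(P_{2t}\Diamond_2 C_3)\le 5$ if $t\ge 4$. Moreover, equality holds for $t\in\{1,2,3\}$.
   Context: A packing $k$-coloring of a graph $H$ is a map $c:V(H)\to\{1,\ldots,k\}$ such that any two distinct vertices $u,v$ with $c(u)=c(v)=i$ satisfy $d_H(u,v)\ge i+1$. The packing chromatic number $\chi_p(H)$ is the least such $k$. $P_m$ denotes the path $v_1\cdots v_m$ and $C_n$ the cycle on $n$ vertices. Path-aligned product: for positive integers $\ell\mid m$ and a connected vertex-transitive graph $G$ containing $P_\ell$ as a subgraph, $P_m\Diamond_\ell G$ is formed from the path $P_m=v_1\cdots v_m$ and $m/\ell$ pairwise disjoint copies of $G$, where for each $1\le i\le m/\ell$ the consecutive path vertices $v_{(i-1)\ell+1},\ldots,v_{i\ell}$ are identified, in order, with the vertices of a path $P_\ell$ (i.e. $\ell$ consecutive cycle vertices when $G$ is a cycle) in the $i$-th copy of $G$. *)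

(* Defs.v *)
From mathcomp Require Import all_boot.

Set Implicit Arguments.
Unset Strict Implicit.
Unset Printing Implicit Defensive.

(* A finite simple graph is a symmetric irreflexive [rel T] on a finType T. *)

Section Packing.

Variables (T : finType) (e : rel T).

Definition walk (n : nat) (u v : T) : bool :=
  [exists p : n.-tuple T, path e u p && (last u p == v)].

(* A shortest walk has fewer than #|T| edges.  The value is #|T| when v is
   not reachable from u; such pairs are treated as being at infinite distance
   in [packing_coloring]. *)
Definition dist (u v : T) : nat :=
  find (fun n => walk n u v) (iota 0 #|T|).

(* The index i : 'I_k stands for the color i.+1 in {1, ..., k}. *)
Definition color (k : nat) (i : 'I_k) : nat := i.+1.

Definition packing_coloring (k : nat) (c : {ffun T -> 'I_k}) : bool :=
  [forall u, forall v,
     [&& u != v, c u == c v & connect e u v] ==>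
     (color (c u) + 1 <= dist u v)].

Definition packing_colorable (k : nat) : bool :=
  [exists c : {ffun T -> 'I_k}, packing_coloring c].

Lemma packing_colorable_ex : exists k, packing_colorable k.
Proof.
exists #|T|; apply/existsP; exists [ffun x => enum_rank x].
apply/forallP => u; apply/forallP => v; rewrite !ffunE (inj_eq enum_rank_inj).
by case: eqP.
Qed.

Definition packing_chromatic : nat := ex_minn packing_colorable_ex.

End Packing.

Definition path_graph (m : nat) : rel 'I_m :=
  fun i j => (i.+1 == j :> nat) || (j.+1 == i :> nat).

(* A simple graph for n >= 3. *)
Definition cycle_graph (n : nat) : rel 'I_n :=
  fun i j => (ordS i == j) || (ordS j == i).

Definition subgraph_path (T : finType) (e : rel T) (l : nat)
  (p : l.-tuple T) : bool := uniq p && sorted e p.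

Arguments path_graph : clear implicits.
Arguments cycle_graph : clear implicits.

Section PathAligned.

Variables (m l : nat) (T : finType) (e : rel T).
(* p i lists, in order, the path chosen in the i-th copy of the graph e. *)
Variable p : 'I_(m %/ l) -> l.-tuple T.

(* (i, x) is the vertex x of the i-th copy.  Copies and path positions are
   numbered from 0, so the j-th vertex of P_m is identified with the vertex
   number j %% l of the path chosen in copy number j %/ l. *)
Definition aligned (x : 'I_(m %/ l) * T) (j : 'I_m) : bool :=
  (x.1 == j %/ l :> nat) && (onth (p x.1) (j %% l) == Some x.2).

(* When l %| m every vertex of P_m is identified with a vertex of a copy, so
   the copies contain all the vertices of the product. *)
Definition path_aligned : rel ('I_(m %/ l) * T) :=
  fun x y => ((x.1 == y.1) && e x.2 y.2)
     || [exists i, exists j, [&& path_graph m i j, aligned x i & aligned y j]].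

End PathAligned.

(* Main.v *)
Require Import Defs.
From mathcomp Require Import all_boot zify.

(** Write a_i b_i for the path edge of the i-th triangle and c_i for its third
    vertex.  Colouring every a_i with 1, every c_i with 2 and the b_i
    periodically with 3 4 3 5 is a packing colouring: the b_i are at mutual
    distance 2|i - j| and the c_i at mutual distance 2|i - j| + 1.  It uses
    three colours for t = 1, four for t <= 3 and five in general.
    Conversely each triangle needs three colours, and with exactly three
    colours two consecutive triangles would both contain the colour 3, although
    their vertices are at distance at most 3. *)

Set Implicit Arguments.
Unset Strict Implicit.
Unset Printing Implicit Defensive.

Section Distance.

Variables (T : finType) (e : rel T).

Lemma walkP n (u v : T) :
  reflect (exists s : seq T, [/\ size s = n, path e u s & last u s = v])
          (walk e n u v).
Proof.
apply: (iffP existsP) => [[q /andP[eq_q /eqP last_q]]|[s [size_s es last_s]]].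
  by exists q; rewrite size_tuple.
have size_sE : size s == n by rewrite size_s.
by exists (Tuple size_sE); rewrite /= es last_s eqxx.
Qed.

Lemma walk_cat m n u v w :
  walk e m u v -> walk e n v w -> walk e (m + n) u w.
Proof.
move=> /walkP[s [ss es ls]] /walkP[r [sr er lr]]; apply/walkP.
by exists (s ++ r); rewrite size_cat cat_path last_cat ss sr ls es er.
Qed.

Lemma walk0 u : walk e 0 u u.
Proof. by apply/walkP; exists [::]. Qed.

Lemma walk1 u v : e u v -> walk e 1 u v.
Proof. by move=> euv; apply/walkP; exists [:: v]; rewrite /= euv. Qed.

Lemma walk_connect n u v : walk e n u v -> connect e u v.
Proof. by move=> /walkP[s [_ es ls]]; apply/connectP; exists s. Qed.

Lemma dist_le n u v : walk e n u v -> dist e u v <= n.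
Proof.
move=> w; rewrite leqNgt; apply/negP => lt_n.
have n_lt : n < #|T|.
  by apply: leq_trans lt_n _; rewrite -[leqRHS](size_iota 0) find_size.
by have := before_find 0 lt_n; rewrite nth_iota // add0n w.
Qed.

Lemma walk_dist u v : connect e u v -> walk e (dist e u v) u v.
Proof.
case/connectP => s es ->; case/shortenP: es => r er ur _.
have sr : size r < #|T| by rewrite -[X in X <= _](card_uniqP ur) max_card.
have hasw : has (fun n => walk e n u (last u r)) (iota 0 #|T|).
  apply/hasP; exists (size r); first by rewrite mem_iota add0n.
  by apply/walkP; exists r.
have := nth_find 0 hasw; rewrite nth_iota ?add0n //.
by rewrite -[ltnRHS](size_iota 0) -has_find.
Qed.

Lemma lipschitz_dist (f : T -> nat) u v :
  (forall x y, e x y -> (f x <= (f y).+1) && (f y <= (f x).+1)) ->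
  connect e u v ->
  (f v <= f u + dist e u v) && (f u <= f v + dist e u v).
Proof.
move=> fL /walk_dist/walkP[s [<- es <-]] {v}.
elim: s u es => [|x s IHs] u /=; first by rewrite addn0 leqnn.
by case/andP => /fL eux /IHs; lia.
Qed.

End Distance.

Lemma cycle_graph3 (x y : 'I_3) : cycle_graph 3 x y = (x != y).
Proof. by case: x => [[|[|[|]]] ?]; case: y => [[|[|[|]]] ?]. Qed.

Section Triangles.

Variables (t : nat) (p : 'I_((2 * t) %/ 2) -> 2.-tuple 'I_3).
Hypothesis hp : forall i, subgraph_path (cycle_graph 3) (p i).

Local Notation V := ('I_((2 * t) %/ 2) * 'I_3)%type.
Local Notation E := (path_aligned (cycle_graph 3) p).

(* 0, 1 and 2 for the vertices called a_i, b_i and c_i in the header. *)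
Definition kind (x : V) : nat := index x.2 (p x.1).

Lemma p_uniq i : uniq (p i).
Proof. by case/andP: (hp i). Qed.

Lemma kind_le2 x : kind x <= 2.
Proof. by rewrite /kind -[leqRHS](size_tuple (p x.1)) index_size. Qed.

Lemma copies_lt (i : 'I_((2 * t) %/ 2)) : i < t.
Proof. by rewrite -[ltnRHS](mulKn t (isT : 0 < 2)). Qed.

Lemma copies_index k : k < t -> {i : 'I_((2 * t) %/ 2) | i = k :> nat}.
Proof.
move=> lt_k; have lt_k2 : k < (2 * t) %/ 2 by rewrite mulKn.
by exists (Ordinal lt_k2).
Qed.

Lemma kind_inj (x y : V) : x.1 = y.1 -> kind x = kind y -> x = y.
Proof.
case: x y => [i x] [j y]; rewrite /kind /= => <- {j} kxy; congr pair.
have [xp|xp] := boolP (x \in p i : bool).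
  have yp : y \in (p i : seq _) by rewrite -index_mem -kxy index_mem.
  by rewrite -(nth_index x xp) kxy nth_index.
have yp : y \notin (p i : seq _) by rewrite -index_mem -kxy index_mem.
apply/eqP/negPn/negP => nxy.
have u4 : uniq [:: x, y & p i] by rewrite /= inE negb_or nxy xp yp p_uniq.
have := max_card [in [:: x, y & p i]].
by rewrite (card_uniqP u4) /= size_tuple card_ord.
Qed.

Lemma alignedE (x : V) (j : 'I_(2 * t)) :
  aligned p x j = (kind x < 2) && (2 * x.1 + kind x == j).
Proof.
have j2 : j %% 2 < size (p x.1) by rewrite size_tuple ltn_mod.
rewrite /aligned onthE (nth_map x.2) //.
rewrite /kind; have [xp|xp] := boolP (x.2 \in (p x.1 : seq _)).
  have := xp; rewrite -index_mem size_tuple => k2; rewrite k2 /=.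
  have -> : (Some (nth x.2 (p x.1) (j %% 2)) == Some x.2)
          = (index x.2 (p x.1) == j %% 2).
    rewrite (inj_eq Some_inj) -{2}(nth_index x.2 xp).
    by rewrite nth_uniq ?index_mem ?p_uniq // eq_sym.
  lia.
have -> : (Some (nth x.2 (p x.1) (j %% 2)) == Some x.2) = false.
  by apply/eqP => -[xE]; move/negP: xp; apply; rewrite -xE mem_nth.
by rewrite andbF memNindex // size_tuple.
Qed.

Lemma edge_cases (x y : V) : E x y ->
  x.1 = y.1 \/ [/\ kind x < 2, kind y < 2 &
    (2 * x.1 + kind x).+1 = 2 * y.1 + kind y \/
    (2 * y.1 + kind y).+1 = 2 * x.1 + kind x].
Proof.
case/orP => [/andP[/eqP-> _]|/existsP[i /existsP[j]]]; first by left.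
rewrite !alignedE /path_graph => /and3P[ij /andP[kx /eqP xi] /andP[ky /eqP yj]].
by right; split=> //; rewrite xi yj; case/orP: ij => /eqP; [left | right].
Qed.

(* Placing c_i at the position of a_i for i <= s, and at that of b_i for i > s,
   keeps the map 1-Lipschitz and, for i > s, realises the distance
   2(i - s) + 1 between c_s and c_i. *)
Definition position (s : nat) (x : V) : nat :=
  2 * x.1 + (if kind x < 2 then kind x else s < x.1).

Lemma position_lipschitz s (x y : V) : E x y ->
  (position s x <= (position s y).+1) && (position s y <= (position s x).+1).
Proof.
rewrite /position; case/edge_cases => [->|[-> ->]]; last by lia.
by case: ifP; case: ifP; case: (s < y.1); lia.
Qed.

Definition pattern (x : V) : nat :=
  nth 0 [:: 0; nth 0 [:: 2; 3; 2; 4] (x.1 %% 4); 1] (kind x).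

Lemma pattern_cases (x : V) :
  [\/ kind x = 0 /\ pattern x = 0,
      kind x = 2 /\ pattern x = 1,
      kind x = 1 /\ (~~ odd x.1 /\ pattern x = 2)
    | kind x = 1 /\ (x.1 %% 4 = 1 /\ pattern x = 3
                  \/ x.1 %% 4 = 3 /\ pattern x = 4)].
Proof.
rewrite /pattern; case: (kind x) (kind_le2 x) => [|[|[|]]] //= _.
- by constructor 1.
- have : x.1 %% 4 < 4 by rewrite ltn_mod.
  case E4: (x.1 %% 4) => [|[|[|[|]]]] //= _.
  + by constructor 3; split=> //; split=> //; lia.
  + by constructor 4; split=> //; left.
  + by constructor 3; split=> //; split=> //; lia.
  + by constructor 4; split=> //; right.
- by constructor 2.
Qed.

Lemma pattern_dist (u v : V) : u != v -> pattern u = pattern v ->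
  connect E u v -> (pattern u).+2 <= dist E u v.
Proof.
move=> nuv puv cuv.
have := lipschitz_dist (@position_lipschitz (minn u.1 v.1)) cuv.
have kuv : kind u = kind v.
  by move: puv; case: (pattern_cases u); case: (pattern_cases v); lia.
have nuv1 : u.1 <> v.1 :> nat.
  by move=> /val_inj uv1; case/eqP: nuv; apply: kind_inj.
rewrite /position.
by move: puv; case: (pattern_cases u); case: (pattern_cases v);
   rewrite -kuv; case: (kind u) => [|[|[|]]] //=; lia.
Qed.

Lemma pattern_bound (x : V) : pattern x < 3 + (1 < t) + (3 < t).
Proof.
have := copies_lt x.1.
by case: (pattern_cases x); case: (ltnP 1 t); case: (ltnP 3 t); lia.
Qed.

Lemma pattern_colorable k : 3 + (1 < t) + (3 < t) <= k ->
  packing_colorable E k.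
Proof.
move=> le_k; apply/existsP.
exists [ffun x => Ordinal (leq_trans (pattern_bound x) le_k)].
apply/forallP => u; apply/forallP => v; rewrite !ffunE -val_eqE /= /color addn1.
by apply/implyP => /and3P[nuv /eqP puv cuv]; apply: pattern_dist.
Qed.

Lemma triangle_walk (x y : V) :
  x.1 = y.1 -> exists2 n, n <= 1 & walk E n x y.
Proof.
move=> xy1; have [<-|nxy] := eqVneq x y; first by exists 0; rewrite ?walk0.
exists 1 => //; apply: walk1; rewrite /path_aligned xy1 eqxx cycle_graph3 /=.
by apply/orP; left; apply: contra nxy; case: x y xy1 => [? ?] [? ?] /= -> /eqP->.
Qed.

Lemma next_triangle_walk (x y : V) :
  y.1 = x.1.+1 :> nat -> exists2 n, n <= 3 & walk E n x y.
Proof.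
move=> xy1.
pose b : V := (x.1, tnth (p x.1) (inord 1)).
pose a : V := (y.1, tnth (p y.1) ord0).
have kb : kind b = 1.
  by rewrite /kind /= (tnth_nth ord0) inordK // index_uniq ?size_tuple ?p_uniq.
have ka : kind a = 0.
  by rewrite /kind /= (tnth_nth ord0) index_uniq ?size_tuple ?p_uniq.
have y1t := copies_lt y.1.
have lt_b : 2 * x.1 + 1 < 2 * t by lia.
have lt_a : 2 * y.1 < 2 * t by lia.
have Eba : E b a.
  apply/orP; right; apply/existsP; exists (Ordinal lt_b).
  apply/existsP; exists (Ordinal lt_a).
  by rewrite !alignedE ka kb /path_graph /= xy1; lia.
have [m m1 wm] : exists2 n, n <= 1 & walk E n x b by apply: triangle_walk.
have [n n1 wn] : exists2 n, n <= 1 & walk E n a y by apply: triangle_walk.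
exists (m + 1 + n); first by lia.
by apply: walk_cat wn; apply: walk_cat (walk1 Eba).
Qed.

Section Coloring.

Variables (k : nat) (c : {ffun V -> 'I_k}).
Hypothesis hc : packing_coloring E c.

Lemma color_lt_walk n u v : u != v -> c u = c v -> walk E n u v -> c u < n.-1.
Proof.
move=> nuv cuv w; have := forallP (forallP hc u) v.
rewrite nuv cuv eqxx (walk_connect w) /color /= => le_d.
by have := leq_trans le_d (dist_le w); lia.
Qed.

Lemma triangle_color_inj i : injective (fun x => c (i, x)).
Proof.
move=> x y cxy; apply/eqP/negPn/negP => nxy.
have [n n1 w] : exists2 n, n <= 1 & walk E n (i, x) (i, y).
  exact: triangle_walk.
have /color_lt_walk : (i, x) != (i, y) by rewrite xpair_eqE eqxx.
by move=> /(_ _ cxy w); lia.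
Qed.

Lemma colors_ge3 : 0 < t -> 3 <= k.
Proof.
case/copies_index => i _.
by have := leq_card _ (@triangle_color_inj i); rewrite !card_ord.
Qed.

Lemma colors_ge4 : 1 < t -> 4 <= k.
Proof.
move=> t2; have [i i0] := copies_index (ltnW t2); have [j j1] := copies_index t2.
have := colors_ge3 (ltnW t2); rewrite leq_eqVlt => /orP[/eqP k3|//].
have k_gt2 : 2 < k by rewrite -k3.
have onto h : exists x, c (h, x) = Ordinal k_gt2.
  have le_k : #|'I_k| <= #|'I_3| by rewrite !card_ord -k3.
  have /codomP[x] := inj_card_onto (@triangle_color_inj h) le_k (Ordinal k_gt2).
  by exists x.
have [[x cx] [y cy]] := (onto i, onto j).
have [n n3 w] : exists2 n, n <= 3 & walk E n (i, x) (j, y).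
  by apply: next_triangle_walk; rewrite /= i0 j1.
have nij : (i, x) != (j, y) by rewrite xpair_eqE -val_eqE /= i0 j1.
have := color_lt_walk nij (etrans cx (esym cy)) w.
by rewrite cx /=; lia.
Qed.

End Coloring.

End Triangles.

Theorem theorem10 (t : nat) (ht : 1 <= t)
  (p : 'I_((2 * t) %/ 2) -> 2.-tuple 'I_3)
  (hp : forall i, subgraph_path (cycle_graph 3) (p i)) :
  let chi := packing_chromatic (path_aligned (cycle_graph 3) p) in
  [/\ t = 1 -> chi <= 3,
      2 <= t <= 3 -> chi <= 4,
      4 <= t -> chi <= 5
    & (t = 1 -> chi = 3) /\ (2 <= t <= 3 -> chi = 4)].
Proof.
rewrite /packing_chromatic; case: ex_minnP => k /existsP[c hc] kmin /=.
have k3 := colors_ge3 hc ht.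
have k4 := colors_ge4 hp hc.
have := kmin _ (pattern_colorable hp (leqnn _)).
by case: (ltnP 1 t) k4; case: (ltnP 3 t) => /=; split; lia.
Qed.
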